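(* Let $y$ be an algebraic number of degree $n$ such that $\sum_{r=0}^{n-1}\alpha_r y^r+y^n=0$ with $\alpha_r\in\mathbb{Q}$, and let $\vec v=(y^{n-1},\dots,y,1)^T$. Write $Q_{1,\vec v}=(Q_1,\dots,Q_n)$. Then for all $i,j,k\in\{1,\dots,n\}$, \[ (Q_i)_{j,k}=\begin{cases}1 & \text{if } i\le j,\ k=j-i+1,\\ \alpha_{n-i+1+j-k} & \text{if } 2\le i\le j,\ k\in\{j-i+2,\dots,j\},\\ -\alpha_{n-i+1+j-k} & \text{if } j<i,\ j+1\le k\le n+j-i+1,\\ 0&\text{otherwise.}\end{cases} \]
   Context: For a number field $K$ with $\mathbb{Q}$-basis $\vec v=(v_1,\dots,v_n)^T$ and $\mu\in K$, $T_\mu^{\vec v}\in\mathbb{Q}^{n,n}$ is the matrix of the $\mathbb{Q}$-linear map $x\mapsto\mu x$ in the basis $\vec v$ (its $i$-th column is the coordinate vector of $\mu v_i$ in the basis $\vec v$). $A_{\bullet,\ell}$ denotes the $\ell$-th column of a matrix $A$. $Q_{1,\vec v}=(Q_1,\dots,Q_n)$ denotes the (unique) $n$-tuple of matrices in $\mathbb{Q}^{n,n}$ such that for every $\mu\in K$ the matrix $N=(T_\mu^{\vec v})^T$ satisfies $Q_iN_{\bullet,1}=N_{\bullet,i}$ for all $i\in\{1,\dots,n\}$. *)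

(* Defs.v *)
From mathcomp Require Import all_boot all_order all_algebra all_field.

Set Implicit Arguments.
Unset Strict Implicit.
Unset Printing Implicit Defensive.

Import GRing.Theory.
Local Open Scope ring_scope.

(* K is a number field, and v a Q-basis of it wherever mulT is used. *)
Definition mulT (K : fieldExtType rat) (n : nat) (v : n.-tuple K) (mu : K) :
    'M[rat]_n :=
  \matrix_(j < n, i < n) coord v j (mu * tnth v i).

(* The size is n.+1 so that a first column exists (a number field has positive
   degree); ord0 is the index written 1 on paper. *)
Definition is_Q1 (K : fieldExtType rat) (n : nat) (v : n.+1.-tuple K)
    (Q : n.+1.-tuple 'M[rat]_n.+1) : Prop :=
  forall (mu : K) (i : 'I_n.+1),
    let N := (mulT v mu)^T in tnth Q i *m col ord0 N = col i N.

Lemma is_Q1_exists_unique (K : fieldExtType rat) (n : nat)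
    (v : n.+1.-tuple K) :
  basis_of {:K} v -> exists! Q : n.+1.-tuple 'M[rat]_n.+1, is_Q1 v Q.
Proof.
move=> bv; have fv := basis_free bv.
pose B i := \matrix_(j < n.+1, m < n.+1) coord v i (tnth v m * tnth v j).
have colN mu i : col i (mulT v mu)^T = B i *m (\col_m coord v m mu).
  apply/colP=> j; rewrite !mxE.
  rewrite {1}(coord_basis bv (memvf mu)) mulr_suml linear_sum /=.
  apply: eq_bigr => m _; rewrite !mxE -scalerAl linearZ /= mulrC.
  by rewrite -tnth_nth.
have uA : B ord0 \in unitmx.
  rewrite -unitmx_tr -row_free_unit; apply: inj_row_free => x xA.
  pose mu := \sum_m x 0 m *: v`_m.
  have cmu j : coord v ord0 (mu * tnth v j) = 0.
    move/rowP/(_ j): xA; rewrite !mxE => <-.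
    rewrite mulr_suml linear_sum; apply: eq_bigr => m _.
    by rewrite !mxE -scalerAl linearZ /= -tnth_nth.
  have cmuT z : coord v ord0 (mu * z) = 0.
    rewrite (coord_basis bv (memvf z)) mulr_sumr linear_sum big1 // => j _.
    by rewrite -scalerAr linearZ /= -tnth_nth cmu mulr0.
  have mu0 : mu = 0.
    apply/eqP; apply: contraT => nz; move: (cmuT (mu^-1 * v`_(ord0 : 'I_n.+1))).
    by rewrite mulVKf // coord_free // eqxx => /eqP; rewrite oner_eq0.
  apply/rowP=> m; rewrite mxE -(coord_sum_free (x 0) m fv) -/mu mu0.
  by rewrite linear0.
exists [tuple B i *m invmx (B ord0) | i < n.+1]; split.
  by move=> mu i /=; rewrite tnth_mktuple !colN mulmxA mulmxKV.
move=> Q hQ; apply: eq_from_tnth => i; rewrite tnth_mktuple.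
suff -> : B i = tnth Q i *m B ord0 by rewrite mulmxK.
apply/matrixP=> j m; have /= := hQ (tnth v m) i.
rewrite !colN => /colP/(_ j).
have -> : \col_m0 coord v m0 (tnth v m) = delta_mx m 0 :> 'cV_n.+1.
  by apply/colP=> l; rewrite !mxE eqxx andbT (tnth_nth 0) coord_free // eq_sym.
by rewrite mulmxA -!colE !mxE.
Qed.

Definition powers_desc (K : fieldExtType rat) (n : nat) (y : K) :
  n.+1.-tuple K := [tuple y ^+ (n - i) | i < n.+1].

Lemma powers_desc_basis (K : fieldExtType rat) (n : nat) (y : K) :
  <<1; y>>%VS = {:K}%VS -> adjoin_degree 1 y = n.+1 ->
  basis_of {:K} (powers_desc n y).
Proof.
move=> gen deg.
have dimK : \dim {:K} = n.+1.
  by rewrite -gen -[RHS]deg dim_Fadjoin dimv1 muln1.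
rewrite basisEdim size_tuple dimK leqnn andbT -gen.
apply/subvP=> z /Fadjoin_poly_eq <-.
set p := Fadjoin_poly _ _ _.
have sp : (size p <= n.+1)%N by rewrite -deg size_Fadjoin_poly.
have : p \is a polyOver 1%VS by apply: Fadjoin_polyOver.
move/polyOverP=> p1; rewrite (horner_coef_wide _ sp); apply: memv_suml => i _.
have /vlineP[c ->] := p1 i; rewrite -scalerAl mul1r memvZ // memv_span //.
apply/tnthP; exists (rev_ord i).
by rewrite tnth_mktuple /= subSS subKn // -ltnS.
Qed.

(* All indices i, j, k are 1-based, in {1, ..., n}; in each branch the
   truncated subtractions agree with integer subtraction. *)
Definition Q1_entry (n : nat) (alpha : nat -> rat) (i j k : nat) : rat :=
  if (i <= j)%N && (k == j - i + 1)%N then 1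
  else if [&& (2 <= i)%N, (i <= j)%N & (j - i + 2 <= k <= j)%N]
  then alpha (n - i + 1 + j - k)%N
  else if (j < i)%N && (j + 1 <= k <= n + j - i + 1)%N
  then - alpha (n - i + 1 + j - k)%N
  else 0.

(* Main.v *)
Require Import Defs.
From mathcomp Require Import all_boot all_order all_algebra all_field.
From mathcomp Require Import zify.

Import GRing.Theory.
Local Open Scope ring_scope.

(** Put p = X^(n+1) + sum_r alpha_r X^r and let d_i be the truncated Horner
    value y^i + alpha_n y^(i-1) + ... + alpha_(n+1-i).  Comparing coordinates of
    w and y w gives coord_(i+1) w = coord_i (y w) + alpha_(n-i) coord_0 w, so
    coord_i w = coord_0 (d_i w): the d_i form the basis dual to the powers of y
    for the form (a, b) |-> coord_0 (a b).  Hence row j of Q_i consists of the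
    coordinates of d_i y^(n-j); these are read off directly when i <= j, and
    from p(y) = 0 (which rewrites the head of p as minus its tail) when j < i. *)

(** The coefficients of p. Including the leading 1 lets the entries [1] and [alpha _] of [Q1_entry]
    be handled by one formula. *)
Definition monic_coef (n : nat) (alpha : nat -> rat) (r : nat) : rat :=
  if r == n.+1 then 1 else alpha r.

Definition horner_head {K : fieldExtType rat} (n : nat) (alpha : nat -> rat)
    (y : K) (i : nat) : K :=
  \sum_(0 <= s < i.+1) monic_coef n alpha (n.+1 - s) *: y ^+ (i - s).

Lemma horner_head0 (K : fieldExtType rat) n alpha (y : K) :
  horner_head n alpha y 0 = 1.
Proof.
by rewrite /horner_head big_nat1 /monic_coef subn0 eqxx scale1r subn0 expr0.
Qed.

(** Horner's recursion for d_i; it mirrors the coordinate recursion in [coord_powers_descS]. *)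
Lemma horner_headS (K : fieldExtType rat) n alpha (y : K) i :
  horner_head n alpha y i.+1
    = y * horner_head n alpha y i + (alpha (n - i)%N)%:A.
Proof.
rewrite /horner_head big_nat_recr //= subnn expr0 subSS; congr (_ + _); last first.
  by rewrite /monic_coef; case: eqP => //; lia.
rewrite mulr_sumr; apply: eq_big_nat => s /andP[_ ltsi].
by rewrite -scalerAr -exprS; congr (_ *: _ ^+ _); lia.
Qed.

Lemma sum_monic_coef (K : fieldExtType rat) n alpha (y : K) :
  \sum_(0 <= r < n.+2) monic_coef n alpha r *: y ^+ r
    = \sum_(r < n.+1) alpha r *: y ^+ r + y ^+ n.+1.
Proof.
rewrite big_nat_recr //= {2}/monic_coef eqxx scale1r; congr (_ + _).
rewrite big_mkord; apply: eq_bigr => r _.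
by rewrite /monic_coef ltn_eqF.
Qed.

(** Cut p(y) at degree n+1-i: the i+1 top terms share the factor y^(n+1-i), and their quotient by it
    is d_i. *)
Lemma horner_head_tail (K : fieldExtType rat) n alpha (y : K) i :
  (i <= n.+1)%N ->
  \sum_(0 <= r < n.+2) monic_coef n alpha r *: y ^+ r
    = y ^+ (n.+1 - i) * horner_head n alpha y i
      + \sum_(0 <= r < n.+1 - i) monic_coef n alpha r *: y ^+ r.
Proof.
move=> lein; rewrite (@big_cat_nat _ _ _ (n.+1 - i)) //=; last lia.
rewrite addrC; congr (_ + _).
rewrite -{1}[(n.+1 - i)%N]add0n big_addn big_nat_rev mulr_sumr /=.
rewrite (_ : n.+2 - (n.+1 - i) = i.+1)%N; last lia.
apply: eq_big_nat => s /andP[_ ltsi].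
by rewrite -scalerAr -exprD; congr (monic_coef _ _ _ *: _ ^+ _); lia.
Qed.

(** The isolated entry 1 at k = j-i is the leading coefficient of p, so the first two branches merge
    into one interval of k. *)
Lemma Q1_entry_le n alpha (i j k : nat) : (i <= j)%N -> (j <= n)%N ->
  Q1_entry n.+1 alpha i.+1 j.+1 k.+1
    = if (j - i <= k < j.+1)%N then monic_coef n alpha (n.+1 - i + j - k) else 0.
Proof.
move=> leij lejn; rewrite /Q1_entry /monic_coef.
repeat case: ifP; try lia; move=> *; try by [].
all: try (congr (alpha _); lia).
all: lia.
Qed.

(** Here the coefficient index lies between 0 and n-i, so the leading coefficient never occurs. *)
Lemma Q1_entry_gt n alpha (i j k : nat) : (j < i)%N -> (i <= n)%N ->
  Q1_entry n.+1 alpha i.+1 j.+1 k.+1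
    = if (j.+1 <= k < n.+2 + j - i)%N
      then - monic_coef n alpha (n.+1 + j - i - k) else 0.
Proof.
move=> ltji lein; rewrite /Q1_entry /monic_coef.
repeat case: ifP; try lia; move=> *; try by [].
all: try (congr (- alpha _); lia).
all: lia.
Qed.

Lemma sum_nat_if (V : zmodType) (a b m : nat) (F : nat -> V) : (b <= m)%N ->
  \sum_(0 <= k < m) (if (a <= k < b)%N then F k else 0) = \sum_(a <= k < b) F k.
Proof.
move=> lebm; rewrite -big_mkcond [RHS](big_nat_widen _ _ _ _ _ lebm).
by rewrite [RHS](big_nat_widenl _ 0) //=; apply: eq_bigl => k; rewrite andbC.
Qed.

Lemma horner_head_mul_power (K : fieldExtType rat) n (alpha : nat -> rat) (y : K)
    (i j : nat) :
  \sum_(r < n.+1) alpha r *: y ^+ r + y ^+ n.+1 = 0 ->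
  (i <= n)%N -> (j <= n)%N ->
  horner_head n alpha y i * y ^+ (n - j)
    = \sum_(k < n.+1) Q1_entry n.+1 alpha i.+1 j.+1 k.+1 *: y ^+ (n - k).
Proof.
move=> y_root lein lejn.
rewrite -(big_mkord xpredT
  (fun k => Q1_entry n.+1 alpha i.+1 j.+1 k.+1 *: y ^+ (n - k))).
have [leij|ltji] := leqP i j.
  under eq_bigr => k _ do
    rewrite Q1_entry_le // (fun_if (fun c => c *: y ^+ (n - k))) scale0r.
  (* With s = k-(j-i), the term of d_i y^(n-j) at s has exponent n-k; since i <= j, no exponent
     exceeds n and no reduction by p is required. *)
  rewrite sum_nat_if // -{1}[(j - i)%N]add0n big_addn.
  rewrite (_ : j.+1 - (j - i) = i.+1)%N; last lia.
  rewrite /horner_head mulr_suml; apply: eq_big_nat => s /andP[_ ltsi].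
  by rewrite -scalerAl -exprD; congr (monic_coef _ _ _ *: _ ^+ _); lia.
under eq_bigr => k _ do
  rewrite Q1_entry_gt // (fun_if (fun c => c *: y ^+ (n - k))) scale0r.
rewrite sum_nat_if; last lia.
have := horner_head_tail K n alpha y i (leqW lein).
rewrite sum_monic_coef y_root => /esym/eqP; rewrite addr_eq0 => /eqP head_eq.
(* Since j < i, the factor y^(n-j) contains the y^(n+1-i) that completes d_i to the head of p(y),
   which equals minus the tail. *)
rewrite (_ : n - j = (n.+1 - i) + (i - j.+1))%N; last lia.
rewrite exprD mulrA [_ * y ^+ (n.+1 - i)]mulrC head_eq mulNr mulr_suml -sumrN.
(* The tail is summed by increasing powers of y, whereas increasing k means decreasing powers; hence
   the reversal. *)
rewrite -[X in _ = \sum_(X <= _ < _) _]add0n big_addn [RHS]big_nat_rev /=.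
rewrite (_ : n.+2 + j - i - j.+1 = n.+1 - i)%N; last lia.
apply: eq_big_nat => r /andP[_ ltr].
rewrite -scalerAl -exprD -scaleNr.
by congr (- monic_coef _ _ _ *: _ ^+ _); lia.
Qed.

Lemma coord_powers_descS (K : fieldExtType rat) n (y : K)
    (alpha : nat -> rat) (i : 'I_n.+1) (lt_i : (i.+1 < n.+1)%N) (w : K) :
  basis_of {:K} (powers_desc n y) ->
  \sum_(r < n.+1) alpha r *: y ^+ r + y ^+ n.+1 = 0 ->
  coord (powers_desc n y) (Ordinal lt_i) w
    = coord (powers_desc n y) i (y * w)
      + alpha (n - i)%N * coord (powers_desc n y) ord0 w.
Proof.
move=> bv y_root; have fv := basis_free bv.
set v := powers_desc n y in bv fv *.
have vE (k : 'I_n.+1) : v`_k = y ^+ (n - k) by rewrite -tnth_nth tnth_mktuple.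
rewrite (coord_basis bv (memvf w)) mulr_sumr !linear_sum /= mulr_sumr -big_split.
apply: eq_bigr => k _ /=; rewrite -scalerAr !linearZ /= mulrCA -mulrDr.
congr (_ * _); rewrite !coord_free //.
(* It remains to check basis vectors. For k = 0, y v_0 = y^(n+1) is reduced by p, and the [alpha]
   term cancels its coordinate; for k > 0, multiplication by y merely shifts v_k to v_(k-1). *)
have [k0|k_gt0] := posnP k.
  have -> : k = ord0 by apply: val_inj.
  rewrite eqxx mulr1 vE -exprS subn0.
  move/eqP: y_root; rewrite addrC addr_eq0 => /eqP ->.
  have -> : \sum_(r < n.+1) alpha r *: y ^+ r
      = \sum_(k < n.+1) alpha (n - k)%N *: v`_k.
    rewrite (reindex_inj rev_ord_inj) /=; apply: eq_bigr => r _.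
    by rewrite vE subSS.
  rewrite linearN /= (coord_sum_free (fun k : 'I_n.+1 => alpha (n - k)%N)) //.
  by rewrite addNr.
have lt_k : (k.-1 < n.+1)%N := leq_ltn_trans (leq_pred k) (ltn_ord k).
have -> : y * v`_k = v`_(Ordinal lt_k).
  by rewrite !vE -exprS /=; congr (_ ^+ _); have := ltn_ord k; lia.
rewrite coord_free // -!val_eqE /=.
rewrite [k == 0%N :> nat]gtn_eqF // mulr0 addr0; congr ((nat_of_bool _)%:R).
by case: (nat_of_ord k) k_gt0.
Qed.

Lemma coord_powers_desc (K : fieldExtType rat) n (y : K)
    (alpha : nat -> rat) (i : 'I_n.+1) (w : K) :
  basis_of {:K} (powers_desc n y) ->
  \sum_(r < n.+1) alpha r *: y ^+ r + y ^+ n.+1 = 0 ->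
  coord (powers_desc n y) i w
    = coord (powers_desc n y) ord0 (horner_head n alpha y i * w).
Proof.
(* The vector [w] stays general because the induction hypothesis is applied to [y * w]. *)
move=> bv y_root; case: i => i; elim: i w => [|i IHi] w lt_i.
  by rewrite horner_head0 mul1r; congr (coord _ _ w); apply: val_inj.
rewrite (@coord_powers_descS _ _ _ alpha (Ordinal (ltnW lt_i))) // IHi /=.
by rewrite horner_headS mulrDl linearD /= -scalerAl mul1r linearZ /= mulrCA mulrA.
Qed.

Theorem theorem3p6 (K : fieldExtType rat) (n : nat) (y : K)
    (alpha : nat -> rat)
    (K_eq_Qy : <<1; y>>%VS = {:K}%VS)
    (deg_y : adjoin_degree 1 y = n.+1)
    (y_root : \sum_(r < n.+1) alpha r *: y ^+ r + y ^+ n.+1 = 0)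
    (Q : n.+1.-tuple 'M[rat]_n.+1)
    (Q_is_Q1 : is_Q1 (powers_desc n y) Q) :
  forall i j k : 'I_n.+1,
    tnth Q i j k = Q1_entry n.+1 alpha i.+1 j.+1 k.+1.
Proof.
have bv := powers_desc_basis K_eq_Qy deg_y.
pose E : n.+1.-tuple 'M[rat]_n.+1 :=
  [tuple \matrix_(j, k) Q1_entry n.+1 alpha i.+1 j.+1 k.+1 | i < n.+1].
(* By uniqueness of the tuple, it suffices that the claimed entries satisfy the defining
   identity. *)
suff E_is_Q1 : is_Q1 (powers_desc n y) E.
  move=> i j k; have [Q' [_ Q'_uniq]] := is_Q1_exists_unique bv.
  by rewrite -(Q'_uniq _ Q_is_Q1) (Q'_uniq _ E_is_Q1) tnth_mktuple mxE.
move=> mu i /=; apply/colP=> j; rewrite tnth_mktuple !mxE.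
(* Entry (j, i) of N becomes coord_0 (mu (d_i y^(n-j))); expanding d_i y^(n-j) in the basis pairs
   row j of the i-th matrix with the first column of N. *)
rewrite (coord_powers_desc _ _ _ _ _ _ bv y_root) mulrCA !tnth_mktuple.
rewrite horner_head_mul_power -1?ltnS // mulr_sumr linear_sum /=.
apply: eq_bigr => k _; rewrite !mxE tnth_mktuple.
by rewrite -scalerAr linearZ.
Qed.
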